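(* Let $K$ be a field, let $d,r\ge 2$ be integers, let $n=dr$, and let $\lambda=(r,r,\dots,r)$ be the partition of $n$ with $d$ parts all equal to $r$. Then for every $\ell$ with $0\le \ell\le n$, the variety $\mathrm{Gr}(\ell,n)^{T_\lambda}$ is irreducible.
   Context: Vectors in $K^n$ are row vectors and matrices act on the right: for a subspace $L\subseteq K^n$, $LT=\{vT: v\in L\}$. The Grassmannian $\mathrm{Gr}(\ell,n)$ parametrizes $\ell$-dimensional subspaces $L$ of $K^n$, regarded as a projective variety in $\mathbb{P}^{\binom n\ell-1}$ via the Plücker embedding. For a nilpotent $n\times n$ matrix $T$, $\mathrm{Gr}(\ell,n)^T=\{L\in \mathrm{Gr}(\ell,n): LT\subseteq L\}$, a closed subvariety. Varieties are identified with their sets of points over an algebraic closure of $K$, with the Zariski topology. For $\lambda=(r,\dots,r)$ with $d$ parts, $T_\lambda$ is the nilpotent $n\times n$ matrix in Jordan canonical form with $d$ Jordan blocks of size $r$: it has entries $1$ in positions $(j,j+1)$ for those $j\in\{1,\dots,n-1\}$ not divisible by $r$, and $0$ elsewhere. *)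

(* Defs.v *)
From HB Require Import structures.
From mathcomp Require Import all_boot all_order all_algebra.
From mathcomp Require Import mpoly.
Set Implicit Arguments.
Unset Strict Implicit.
Unset Printing Implicit Defensive.
Import GRing.Theory.
Local Open Scope ring_scope.

(* A topology on T is given by its closed sets. The empty set is not
   irreducible. *)
Definition irreducible (T : Type) (closed : (T -> Prop) -> Prop)
    (X : T -> Prop) : Prop :=
  (exists x, X x) /\
  forall A B : T -> Prop, closed A -> closed B ->
    (forall x, X x -> A x \/ B x) ->
    (forall x, X x -> A x) \/ (forall x, X x -> B x).

Definition Gr (F : fieldType) (l n : nat) : Type :=
  {L : {vspace 'rV[F]_n} | \dim L == l}.

Lemma card_lsubsets (l n : nat) :
  'C(n, l) = #|[set S : {set 'I_n} | #|S| == l]|.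
Proof. by rewrite card_draws card_ord. Qed.

Definition lsubset (l n : nat) (k : 'I_('C(n, l))) : {set 'I_n} :=
  enum_val (cast_ord (card_lsubsets l n) k).

Lemma card_lsubset (l n : nat) (k : 'I_('C(n, l))) : #|lsubset k| = l.
Proof. by have := enum_valP (cast_ord (card_lsubsets l n) k); rewrite inE => /eqP. Qed.

(* [enum] lists a set of ordinals in increasing order, so [lsubset_col k] is the
   increasing enumeration of the k-th l-subset of the columns. *)
Definition lsubset_col (l n : nat) (k : 'I_('C(n, l))) (j : 'I_l) : 'I_n :=
  enum_val (cast_ord (esym (card_lsubset k)) j).

(* Homogeneous coordinates of the Pluecker point of L: the maximal minors of the
   matrix whose rows form a basis of L. Another basis rescales all of them by
   one common nonzero factor. *)
Definition pluecker (F : fieldType) (l n : nat) (L : Gr F l n)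
    (k : 'I_('C(n, l))) : F :=
  \det (\matrix_(i < l, j < l) (vbasis (val L))`_i 0 (lsubset_col k j)).

(* The topology induced by the Zariski topology of P^('C(n, l) - 1). *)
Definition zariski_closed (F : fieldType) (l n : nat) (Z : Gr F l n -> Prop) :
    Prop :=
  exists I : {mpoly F['C(n, l)]} -> Prop,
    (forall p, I p -> exists e : nat, p \is e.-homog) /\
    (forall L : Gr F l n, Z L <-> (forall p, I p -> p.@[pluecker L] = 0)).

(* Matrices act on row vectors from the right. *)
Definition Gr_fixed (F : fieldType) (l n : nat) (T : 'M[F]_n) (L : Gr F l n) :
    Prop :=
  forall v : 'rV[F]_n, v \in val L -> v *m T \in val L.

(* For n = d * r, the Jordan form with d nilpotent blocks of size r. With 1-based
   indices the entries 1 are at (m, m + 1) for r not dividing m; in the 0-based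
   indices used here, m = i.+1 = j. *)
Definition jordan_rect (R : nzRingType) (n r : nat) : 'M[R]_n :=
  \matrix_(i < n, j < n) ((j == i.+1 :> nat) && ~~ (r %| j)%N)%:R.

Definition is_algebraic_closure (K : fieldType) (F : closedFieldType)
    (iota : {rmorphism K -> F}) : Prop :=
  forall x : F, algebraicOver iota x.

(* Main.v *)
Require Import Defs.
From Stdlib Require Import Classical.
From mathcomp Require Import all_boot all_order all_algebra.
From mathcomp Require Import mpoly zify.
Set Implicit Arguments.
Unset Strict Implicit.
Unset Printing Implicit Defensive.
Import GRing.Theory.
Local Open Scope ring_scope.

(** Let R = F[t]/(t^r). The matrix T makes V = F^n the free module R^d, and the
  points of the variety are the R-submodules of V of dimension l. The proof joins
  any two of them by a rational curve inside the variety.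

  Let L be a submodule of codimension c that contains V t^m. Comparing L with the
  submodules {v | v t^i in L} gives a submodule L1 that contains L and V t, has
  codimension k = c / m (rounded down), and satisfies L1 t^(m-1) <= L
  ([exists_intermediate_submodule]). By Nakayama's lemma L1 = V D_k G, where
  D_k = diag (t, .., t, 1, .., 1) has k entries t and G is an automorphism of the
  module V ([exists_dilation]). The preimage of L under D_k G contains V t^(m-1)
  and has codimension c - k, so induction from m = r down to 0 gives
    L = V D_(k_r) G_r ... D_(k_1) G_1,
  where the numbers k_i depend only on c ([exists_factor]). Hence the variety is
  the image of a set of tuples of automorphisms of V. These are the invertible
  elements of a linear space, so two tuples are joined by a line
  ([exists_curve]).

  Along the line the dimension must not jump. The product N of the D_(k_i) G_i has
  corank at most c = k_1 + ... + k_r. Reversing the order of the factors,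
  inverting the G_i and replacing D_k by D'_k = diag (1, .., 1, t, .., t), which
  satisfies D_k D'_k = t, gives a product N' with N N' = t^r = 0 and corank at
  most d r - c. So rank N + rank N' <= n, and both bounds are equalities wherever
  the G_i are invertible ([power_factor_rank]).

  Finally, if closed sets A and B cover the variety and miss the points L1 and L2
  respectively, pull back equations of A and B that do not vanish there along a
  curve from L1 to L2: a polynomial in one variable has finitely many zeros and F
  is infinite ([irreducible_of_curves]). *)

(** * Subspaces as row spaces *)

Section Subspaces.
Variables (F : fieldType) (n : nat).

Definition preimmx m (f : 'M[F]_n) (L : 'M_(m, n)) : 'M_n :=
  kermx (f *m cokermx L).

Lemma sub_preimmx p m (A : 'M_(p, n)) (f : 'M[F]_n) (L : 'M_(m, n)) :
  (A <= preimmx f L)%MS = (A *m f <= L)%MS.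
Proof. by rewrite /preimmx sub_kermx mulmxA submxE. Qed.

Lemma preimmx_mul m (f : 'M[F]_n) (L : 'M_(m, n)) :
  (preimmx f L *m f :=: f :&: L)%MS.
Proof.
apply/eqmxP/andP; split; first by rewrite sub_capmx submxMl -sub_preimmx /=.
have /submxP [D defD] := capmxSl f L.
by rewrite defD submxMr // sub_preimmx -defD capmxSr.
Qed.

Lemma rank_preimmx m (f : 'M[F]_n) (L : 'M_(m, n)) :
  (\rank (preimmx f L) + \rank f = n + \rank (f :&: L)%MS)%N.
Proof.
have kf : (kermx f <= preimmx f L)%MS by rewrite sub_preimmx mulmx_ker sub0mx.
rewrite -(mxrank_mul_ker _ f) (preimmx_mul f L).
rewrite (capmx_idPr kf) mxrank_ker -addnA subnK ?rank_leq_row //.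
exact: addnC.
Qed.

Lemma exists_sub_rank m (W : 'M[F]_(m, n)) k : (k <= \rank W)%N ->
  exists X : 'M_(k, n), (X <= W)%MS /\ \rank X = k.
Proof.
move=> kW; exists ((pid_mx k : 'M_(k, \rank W)) *m row_base W); split.
  by rewrite (submx_trans (submxMl _ _)) // eq_row_base.
by rewrite mxrankMfree ?row_base_free // rank_pid_mx.
Qed.

Lemma exists_between_rank m p (A : 'M[F]_(m, n)) (B : 'M_(p, n)) k :
    (A <= B)%MS -> (\rank A <= k <= \rank B)%N ->
  exists C : 'M_n, [/\ (A <= C)%MS, (C <= B)%MS & \rank C = k].
Proof.
move=> AB /andP [Ak kB].
have rD : (\rank A + \rank (B :\: A) = \rank B)%N.
  by rewrite -(mxrank_cap_compl B A) (capmx_idPr AB).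
have [|X [XW rX]] := @exists_sub_rank _ (B :\: A)%MS (k - \rank A).
  by rewrite leq_subLR rD.
exists (A + X)%MS; split; first exact: addsmxSl.
  by rewrite addsmx_sub AB (submx_trans XW) ?diffmxSl.
rewrite mxrank_disjoint_sum ?rX ?subnKC //.
apply/eqP; rewrite -submx0 -(capmx_diff B A) sub_capmx capmxSl.
by rewrite (submx_trans (capmxSr _ _) XW).
Qed.

(** The spanning vectors are indexed by nat rather than by an ordinal, so that two
  such lists can be concatenated without casts. *)
Lemma exists_spanning_seq m (W : 'M[F]_(m, n)) k : (\rank W <= k)%N ->
  exists v : nat -> 'rV_n,
    (forall i, (v i <= W)%MS) /\ (W <= \matrix_(i < k) v i)%MS.
Proof.
move=> Wk; exists (fun i => if insub i is Some j then row j (row_base W) else 0).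
split=> [i|].
  case: insubP => [j _ _|_]; last exact: sub0mx.
  by rewrite (submx_trans (row_sub _ _)) // eq_row_base.
rewrite -(eq_row_base W); apply/row_subP=> j.
rewrite (_ : row j _ = row (widen_ord Wk j) (\matrix_(i < k)
  (if insub (i : nat) is Some j then row j (row_base W) else 0))) ?row_sub //.
by rewrite rowK /= valK.
Qed.

(** Sylvester's rank inequality. *)
Lemma mxrank_mul_lower (A B : 'M[F]_n) :
  (\rank A + \rank B <= n + \rank (A *m B))%N.
Proof. by have := mxrank_Frobenius A 1%:M B; rewrite mulmx1 mul1mx mxrank1. Qed.

(** With U i = {v | v T^i in L}, the kernel-image count for T : U (i+1) -> U i gives
  dim U (i+1) - dim U i = codim (U i + V T). These increments decrease with i and
  add up to codim L over i < m, because U m = V. So their mean lies between the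
  first one, codim (L + V T), and the last one, codim U (m-1); hence a subspace L1
  of codimension codim L / m, rounded down, fits between L + V T and U (m-1). It
  is T-stable since it contains V T. *)
Lemma exists_intermediate_submodule (T L : 'M[F]_n) m :
    (0 < m)%N -> stablemx L T -> (T ^+ m <= L)%MS ->
  exists L1 : 'M_n, [/\ (L <= L1)%MS, (T <= L1)%MS, (L1 *m T ^+ m.-1 <= L)%MS
    & (\rank L1 + (n - \rank L) %/ m = n)%N].
Proof.
move=> m_gt0 LT Tm.
pose U i := preimmx (T ^+ i) L.
pose a i := (n - \rank (U i + T)%MS)%N.
have rU0 : \rank (U 0%N) = \rank L.
  by have := rank_preimmx (T ^+ 0) L; rewrite expr0 mxrank1 cap1mx addnC => /addnI.
have stepU i : (\rank (U i.+1) = \rank (U i) + a i)%N.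
  have eqU : (U i.+1 :=: preimmx T (U i))%MS.
    have eqsub p (A : 'M_(p, n)) : (A <= U i.+1)%MS = (A <= preimmx T (U i))%MS.
      by rewrite !sub_preimmx -mulmxA mulmxE -exprS.
    by apply/eqmxP; rewrite -eqsub submx_refl eqsub submx_refl.
  have := rank_preimmx T (U i); rewrite -eqU.
  have := mxrank_sum_cap (U i) T; rewrite capmxC /a => e1 e2.
  have := rank_leq_col (U i + T)%MS.
  move/subnKC; lia.
have monU i j : (i <= j)%N -> (U i <= U j)%MS.
  elim: j => [|j IH]; first by rewrite leqn0 => /eqP ->.
  rewrite leq_eqVlt => /predU1P [-> //|/IH /submx_trans]; apply.
  rewrite sub_preimmx exprSr -mulmxE mulmxA.
  by apply: submx_trans LT; rewrite submxMr // -sub_preimmx.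
have mona i j : (i <= j)%N -> (a j <= a i)%N.
  by move=> ij; rewrite leq_sub2l // mxrankS // addsmxS // monU.
have bounds j : (j <= m)%N ->
    (\rank L + j * a m.-1 <= \rank (U j) <= \rank L + j * a 0)%N.
  elim: j => [|j IH] jm; first by rewrite rU0 addn0 leqnn.
  have /andP [lo hi] := IH (ltnW jm).
  rewrite stepU !mulSn [(a _ + _)%N]addnC [(a 0 + _)%N]addnC !addnA.
  rewrite !leq_add ?mona //.
  by rewrite -ltnS prednK.
have rUm : \rank (U m) = n.
  apply/eqP; rewrite -[_ == n]/(row_full _) -sub1mx sub_preimmx mul1mx //.
have TU : (T <= U m.-1)%MS by rewrite sub_preimmx mulmxE -exprS prednK.
have LU : (U 0 <= U m.-1)%MS by exact: monU.
have /andP [lo hi] := bounds m (leqnn m); rewrite rUm in lo hi.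
have [||L1 [A1 A2 A3]] := @exists_between_rank _ _ (U 0 + T)%MS (U m.-1)
    (n - (n - \rank L) %/ m).
- by rewrite addsmx_sub LU TU.
- have k1 : ((n - \rank L) %/ m <= a 0)%N.
    rewrite -(leq_pmul2l m_gt0) mulnC (leq_trans (leq_divM _ _)) //.
    by rewrite leq_subLR.
  have k2 : (a m.-1 <= (n - \rank L) %/ m)%N.
    by rewrite leq_divRL // mulnC leq_subRL ?rank_leq_row // (leq_trans lo).
  have aE : a m.-1 = (n - \rank (U m.-1))%N by rewrite /a (addsmx_idPl TU).
  have := rank_leq_col (U 0 + T)%MS.
  move: k1 k2; rewrite aE /a; move: (_ %/ m)%N => k.
  by move: (\rank _) (\rank _) => x y; clear; lia.
exists L1; split.
- apply: submx_trans A1; apply: submx_trans (addsmxSl _ _).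
  by rewrite sub_preimmx mulmx1.
- exact: submx_trans (addsmxSr _ _) A1.
- by rewrite -sub_preimmx.
- rewrite A3 subnK //; apply: leq_trans (leq_div _ _) (leq_subr _ _).
Qed.
(** The k unit vectors of index h a and the row space of D span everything. *)
Lemma corank_le_missing_units k (D : 'M[F]_n) (h : 'I_k -> 'I_n) :
    (forall j, ((delta_mx 0 j : 'rV_n) <= D)%MS \/ exists a, j = h a) ->
  (n <= \rank D + k)%N.
Proof.
move=> hD; pose E : 'M[F]_(k, n) := \matrix_(a < k) delta_mx 0 (h a).
have full : (1%:M <= D + E)%MS.
  apply/row_subP=> j; rewrite row1; case: (hD j) => [jD|[a ->]].
    exact: submx_trans jD (addsmxSl _ _).
  apply: submx_trans (addsmxSr _ _).
  by rewrite -[delta_mx 0 _](rowK (fun a => delta_mx 0 (h a))) row_sub.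
have /mxrankS := full; rewrite mxrank1 => /leq_trans; apply.
apply: leq_trans (mxrank_adds_leqif _ _) _.
by rewrite leq_add2l rank_leq_row.
Qed.
End Subspaces.

(** * Polynomial curves of matrices *)

Section MatrixCurves.
Variable F : fieldType.

Definition evalmx m n (x : F) (N : 'M[{poly F}]_(m, n)) := map_mx (horner_eval x) N.

Lemma evalmx_const m n x (A : 'M_(m, n)) : evalmx x (map_mx polyC A) = A.
Proof. by apply/matrixP=> i j; rewrite !mxE /horner_eval hornerC. Qed.

Lemma evalmxM m n p x (A : 'M_(m, n)) (B : 'M_(n, p)) :
  evalmx x (A *m B) = evalmx x A *m evalmx x B.
Proof. exact: map_mxM. Qed.

Definition line m n (A B : 'M[F]_(m, n)) : 'M[{poly F}]_(m, n) :=
  (1 - 'X) *: map_mx polyC A + 'X *: map_mx polyC B.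

Lemma evalmx_line m n x (A B : 'M_(m, n)) :
  evalmx x (line A B) = (1 - x) *: A + x *: B.
Proof. by apply/matrixP=> i j; rewrite !mxE /horner_eval !hornerE. Qed.
End MatrixCurves.

(** * Submodules of a free module over F[t]/(t^r) *)

Section Jordan.
Variables (F : fieldType) (d r n : nat).
Hypotheses (r_gt0 : (0 < r)%N) (hn : n = (d * r)%N).
Local Notation T := (jordan_rect F n r).

Lemma row_jordan (i : 'I_n) :
  (r %| i.+1)%N /\ row i T = 0 \/
  exists j : 'I_n, [/\ (j = i.+1 :> nat), ~~ (r %| j)%N & row i T = delta_mx 0 j].
Proof.
have [ri|ri] := boolP (r %| i.+1)%N.
  left; split=> //; apply/rowP=> j; rewrite !mxE.
  by case: eqP => //= ->; rewrite ri.
have jn : (i.+1 < n)%N.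
  rewrite ltn_neqAle ltn_ord andbT; apply: contraNneq ri => ->.
  by rewrite hn dvdn_mull.
right; exists (Ordinal jn); split=> //; apply/rowP=> j; rewrite !mxE /=.
rewrite -val_eqE /=; by case: eqP => //= ->; rewrite ri.
Qed.

(** The coordinate of index l sits in position l %% r of its block, and T moves
  positions up by one, so T^m has no component in positions below m. *)
Lemma jordan_nilpotent : T ^+ r = 0.
Proof.
suff low m (i l : 'I_n) : (l %% r < m)%N -> (T ^+ m) i l = 0.
  by apply/matrixP=> i l; rewrite low ?mxE // ltn_pmod.
elim: m i l => // m IH i l lm; rewrite exprSr -mulmxE mxE big1 // => j _.
rewrite [T _ _]mxE; case: eqP => [lj|]; last by rewrite mulr0.
have [|rl] := boolP (r %| l)%N; first by rewrite mulr0.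
rewrite IH ?mul0r //.
move: lm rl; rewrite lj => lm rl.
have : (j.+1 %% r = (j %% r).+1)%N.
  by apply/eqP; rewrite modnS (negPf rl).
by move=> e; rewrite e in lm.
Qed.

(** Identify V with R^d, where R = F[t]/(t^r) and T acts as t. Then [dilation k] is
  diag (t, .., t, 1, .., 1) with k entries t, and [codilation k] is its complement
  diag (1, .., 1, t, .., t): their product is t. *)
Definition dilation k : 'M[F]_n :=
  \matrix_(i, j) if (i < k * r)%N then T i j else (i == j)%:R.
Definition codilation k : 'M[F]_n :=
  \matrix_(i, j) if (i < k * r)%N then (i == j)%:R else T i j.

(** The projection of V = R^d onto its first k summands. *)
Definition first_blocks k : 'M[F]_n := diag_mx (\row_i (i < k * r)%:R).

Lemma first_blocksM k (A : 'M[F]_n) i j :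
  (first_blocks k * A) i j = if (i < k * r)%N then A i j else 0.
Proof.
by rewrite -mulmxE mul_diag_mx !mxE; case: ifP => _; rewrite ?mul1r ?mul0r.
Qed.

Lemma first_blocks_comm k : first_blocks k * T = T * first_blocks k.
Proof.
apply/matrixP=> i j; rewrite first_blocksM -mulmxE mul_mx_diag !mxE.
case: eqP => [ji|]; last by rewrite mul0r if_same.
have [|rj] := boolP (r %| j)%N; first by rewrite mul0r if_same.
have -> : (j < k * r)%N = (i < k * r)%N.
  rewrite ji [RHS]leq_eqVlt; case: eqP => // e.
  by move: rj; rewrite ji e dvdn_mull.
by case: ifP; rewrite ?mulr1 ?mulr0.
Qed.

Lemma dilationE k : dilation k = first_blocks k * T + (1 - first_blocks k).
Proof.
apply/matrixP=> i j; rewrite [RHS]mxE first_blocksM !mxE.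
by case: ifP => _; rewrite ?subrr ?addr0 // add0r mul0rn subr0.
Qed.

Lemma codilationE k : codilation k = first_blocks k + (1 - first_blocks k) * T.
Proof.
apply/matrixP=> i j; rewrite mulrBl mul1r [RHS]mxE [X in _ = _ + X]mxE.
rewrite [X in _ = _ + (_ + X)]mxE first_blocksM [in RHS]mxE [in RHS]mxE mxE.
by case: ifP => _; rewrite ?subrr ?addr0 // mul0rn add0r subr0.
Qed.

Lemma dilation_comm k : dilation k * T = T * dilation k.
Proof.
rewrite dilationE mulrDl mulrDr mulrBl mulrBr mul1r mulr1 first_blocks_comm.
by rewrite -mulrA first_blocks_comm.
Qed.

Lemma dilation_codilation k : dilation k * codilation k = T.
Proof.
have PP : first_blocks k * first_blocks k = first_blocks k.
  apply/matrixP=> i j; rewrite first_blocksM !mxE.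
  by case: (i < _)%N; rewrite ?mul0rn.
rewrite dilationE codilationE; set Q := 1 - first_blocks k.
have PQ : first_blocks k * Q = 0 by rewrite mulrBr mulr1 PP subrr.
have QP : Q * first_blocks k = 0 by rewrite mulrBl mul1r PP subrr.
have QQ : Q * Q = Q by rewrite mulrBr QP subr0 mulr1.
have PTP : first_blocks k * T * first_blocks k = first_blocks k * T.
  by rewrite first_blocks_comm -mulrA PP.
have PTQ : first_blocks k * T * Q = 0.
  by rewrite first_blocks_comm -mulrA PQ mulr0.
have QPK : Q + first_blocks k = 1 by rewrite subrK.
clearbody Q; rewrite mulrDr !mulrDl !mulrA PTP PTQ QP QQ mul0r add0r addr0.
by rewrite -mulrDl addrC QPK mul1r.
Qed.

Lemma row_dilation_lt k (i : 'I_n) : (i < k * r)%N -> row i (dilation k) = row i T.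
Proof. by move=> ik; apply/rowP=> j; rewrite !mxE ik. Qed.

Lemma row_dilation_ge k (i : 'I_n) :
  (k * r <= i)%N -> row i (dilation k) = delta_mx 0 i.
Proof. by move=> ik; apply/rowP=> j; rewrite !mxE ltnNge ik /= eq_sym. Qed.

Lemma row_codilation_lt k (i : 'I_n) :
  (i < k * r)%N -> row i (codilation k) = delta_mx 0 i.
Proof. by move=> ik; apply/rowP=> j; rewrite !mxE ik eqxx eq_sym. Qed.

Lemma row_codilation_ge k (i : 'I_n) :
  (k * r <= i)%N -> row i (codilation k) = row i T.
Proof. by move=> ik; apply/rowP=> j; rewrite !mxE ltnNge ik. Qed.

Lemma row_jordan_onto (j : 'I_n) : ~~ (r %| j)%N ->
  exists i : 'I_n, j = i.+1 :> nat /\ row i T = delta_mx 0 j.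
Proof.
move=> rj; have j_gt0 : (0 < j)%N by case: (j : nat) rj; rewrite ?dvdn0.
have i_lt : (j.-1 < n)%N by apply: leq_ltn_trans (leq_pred _) (ltn_ord j).
exists (Ordinal i_lt); split; first by rewrite /= prednK.
apply/rowP=> l; rewrite !mxE /= prednK // -val_eqE /=.
by case: eqP => //= ->; rewrite rj.
Qed.

Lemma corank_dilation k : (k <= d)%N -> (n <= \rank (dilation k) + k)%N.
Proof.
move=> kd; have lt_n (a : 'I_k) : (a * r < n)%N.
  by rewrite hn ltn_pmul2r // (leq_trans (ltn_ord a)).
apply: (@corank_le_missing_units _ _ _ _ (fun a => Ordinal (lt_n a))) => j.
have [jk|jk] := ltnP j (k * r); last by left; rewrite -(row_dilation_ge jk) row_sub.
have [rj|rj] := boolP (r %| j)%N.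
  right; have ak : (j %/ r < k)%N by rewrite ltn_divLR.
  by exists (Ordinal ak); apply: val_inj; rewrite /= divnK.
left; have [i [ji <-]] := row_jordan_onto rj.
by rewrite -(@row_dilation_lt k) ?row_sub // (leq_trans _ jk) // ji.
Qed.

Lemma corank_codilation k : (k <= d)%N -> (n <= \rank (codilation k) + (d - k))%N.
Proof.
move=> kd; have lt_n (a : 'I_(d - k)) : ((k + a) * r < n)%N.
  by have := ltn_ord a; rewrite hn ltn_pmul2r // ltn_subRL.
apply: (@corank_le_missing_units _ _ _ _ (fun a => Ordinal (lt_n a))) => j.
have [jk|jk] := ltnP j (k * r).
  by left; rewrite -(row_codilation_lt jk) row_sub.
have [rj|rj] := boolP (r %| j)%N.
  right; have kj : (k <= j %/ r)%N by rewrite leq_divRL.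
  have ak : (j %/ r - k < d - k)%N.
    by rewrite ltn_sub2rE // ltn_divLR // -hn.
  by exists (Ordinal ak); apply: val_inj; rewrite /= subnKC // divnK.
left; have [i [ji <-]] := row_jordan_onto rj.
rewrite -(@row_codilation_ge k) ?row_sub // -ltnS -ji ltn_neqAle jk andbT.
by apply: contraNneq rj => <-; rewrite dvdn_mull.
Qed.

Lemma corank_jordan : (n <= \rank T + d)%N.
Proof.
rewrite (_ : T = dilation d) ?corank_dilation //.
by apply/matrixP=> i j; rewrite !mxE -hn ltn_ord.
Qed.

(** V is free over R = F[t]/(t^r) on the unit vectors of index a * r, so their
  images v a may be prescribed. *)
Lemma exists_equivariant (v : nat -> 'rV[F]_n) : exists G : 'M_n,
  G * T = T * G /\ forall i : 'I_n, row i G = v (i %/ r)%N *m T ^+ (i %% r).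
Proof.
exists (\matrix_(i < n) (v (i %/ r)%N *m T ^+ (i %% r))).
split=> [|i]; last by rewrite rowK.
apply/row_matrixP=> i; rewrite -!mulmxE !row_mul rowK -mulmxA mulmxE -exprSr.
have [[ri ->]|[j [ji rj ->]]] := row_jordan i.
  rewrite mul0mx (_ : (i %% r).+1 = r) ?jordan_nilpotent ?mulmx0 //.
  move: ri; rewrite /dvdn -addn1 -modnDml addn1.
  by have := ltn_pmod i r_gt0; rewrite leq_eqVlt => /predU1P [-> //|/modn_small ->].
by rewrite -rowE rowK ji divnS // modnS -ji (negPf rj) add0n.
Qed.

(** L1 / V T is a subspace of V / V T = F^d of codimension k. Choose the images of
  the R-basis as a basis of V mod V T whose last d - k members span L1 mod V T.
  By Nakayama's lemma they form an R-basis of V, which gives G, and G carries the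
  submodule t R^k + R^(d-k) onto L1. *)
Lemma exists_dilation (L1 : 'M[F]_n) k :
    (T <= L1)%MS -> (\rank L1 + k = n)%N ->
  (k <= d)%N /\
  exists G : 'M_n, [/\ G \in unitmx, G * T = T * G & (dilation k *m G :=: L1)%MS].
Proof.
move=> TL1 rL1.
have kd : (k <= d)%N.
  by have := corank_jordan; have := mxrankS TL1; move: (\rank T) (\rank L1) rL1; lia.
split=> //.
have [|v0 [_ spanv0]] := @exists_spanning_seq _ _ _ (L1^C)%MS k.
  by rewrite mxrank_compl leq_subLR rL1.
have [|v1 [v1sub spanv1]] := @exists_spanning_seq _ _ _ (L1 :\: T)%MS (d - k).
  have := mxrank_cap_compl L1 T; rewrite (capmx_idPr TL1).
  by have := corank_jordan; move: (\rank T) (\rank L1) (\rank _) rL1; lia.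
pose v a := if (a < k)%N then v0 a else v1 (a - k)%N.
have [G [commG rowG]] := exists_equivariant v.
have vG a : (a < d)%N -> (v a <= G)%MS.
  move=> ad; have ar : (a * r < n)%N by rewrite hn ltn_pmul2r.
  rewrite (_ : v a = row (Ordinal ar) G) ?row_sub // rowG /= mulnK //.
  by rewrite modnMl expr0 mulmx1.
have generates : (1%:M <= G + T)%MS.
  have C0 : (L1^C <= G)%MS.
    apply: submx_trans spanv0 _; apply/row_subP=> a; rewrite rowK.
    by have := vG a; rewrite /v ltn_ord => -> //; apply: leq_trans kd.
  have C1 : (L1 :\: T <= G)%MS.
    apply: submx_trans spanv1 _; apply/row_subP=> a; rewrite rowK.
    have := vG (k + a)%N.
    rewrite /v [(k + a < k)%N]ltnNge leq_addr addKn /= => -> //.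
    by have := ltn_ord a; rewrite ltn_subRL.
  apply: submx_trans (submx_full _ (addsmx_compl_full L1)) _.
  rewrite addsmx_sub (submx_trans C0 (addsmxSl _ _)) andbT.
  rewrite -(addsmx_diff_cap_eq L1 T) addsmx_sub (submx_trans C1 (addsmxSl _ _)).
  by rewrite (submx_trans (capmxSr _ _) (addsmxSr _ _)).
(* V = V G + V T gives V = V G + V T^m for all m, because V G is T-stable. *)
have nakayama m : (1%:M <= G + T ^+ m)%MS.
  elim: m => [|m IH]; first by rewrite expr0 addsmxSr.
  apply: submx_trans IH _; rewrite addsmx_sub addsmxSl /=.
  have := submxMr (T ^+ m) generates; rewrite mul1mx => /submx_trans; apply.
  rewrite addsmxMr addsmx_sub mulmxE -exprS addsmxSr andbT.
  apply: submx_trans (addsmxSl _ _).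
  have -> : G * T ^+ m = T ^+ m * G by exact: (commrX m (commG : GRing.comm G T)).
  exact: submxMl.
have Gunit : G \in unitmx.
  rewrite -row_full_unit -sub1mx; apply: submx_trans (nakayama r) _.
  by rewrite jordan_nilpotent addsmx_sub submx_refl sub0mx.
exists G; split=> //.
have sub : (dilation k *m G <= L1)%MS.
  apply/row_subP=> i; rewrite row_mul.
  have [ik|ik] := ltnP i (k * r).
    rewrite row_dilation_lt // -row_mul mulmxE -commG -mulmxE row_mul.
    by rewrite (submx_trans _ TL1) ?submxMl.
  rewrite row_dilation_ge // -rowE rowG.
  case: (i %% r)%N => [|b].
    rewrite expr0 mulmx1 /v ltnNge leq_divRL // ik /=.
    by rewrite (submx_trans (v1sub _)) ?diffmxSl.
  by rewrite exprSr -mulmxE mulmxA (submx_trans _ TL1) ?submxMl.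
apply/eqmxP; rewrite sub /= -(mxrank_leqif_sup sub).
rewrite mxrankMfree ?row_free_unit //.
have := mxrankS sub; rewrite mxrankMfree ?row_free_unit //.
have := corank_dilation kd; move: (\rank _) (\rank L1) rL1; lia.
Qed.

(** One step of the factorization: L lies in L1 = V A with A = dilation k * G, and
  L' is the preimage of L under A. As L1 T^m lies in L, the submodule L' contains
  V T^m, which is one power of T less than for L. The number k depends on m and c
  alone, hence is the same for all submodules of that dimension. *)
Lemma exists_factor (L : 'M[F]_n) m c :
    stablemx L T -> (T ^+ m.+1 <= L)%MS -> (\rank L + c = n)%N ->
  let k := (c %/ m.+1)%N in (k <= d)%N /\
  exists G L' : 'M[F]_n,
    [/\ G \in unitmx, G * T = T * G, (L' *m (dilation k *m G) :=: L)%MS &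
        [/\ stablemx L' T, (T ^+ m <= L')%MS & (\rank L' + (c - k) = n)%N]].
Proof.
move=> LT Tm rL k.
have cE : (n - \rank L = c)%N by move: (\rank L) rL; lia.
have [L1 [LL1 TL1 L1m]] := exists_intermediate_submodule (ltn0Sn m) LT Tm.
rewrite cE -/k /= in L1m * => rL1.
have [kd [G [Gunit commG eqL1]]] := exists_dilation TL1 rL1.
split=> //; set A := dilation k *m G in eqL1 *.
have commA : A * T = T * A.
  by rewrite /A mulmxE -mulrA commG mulrA dilation_comm mulrA.
exists G, (preimmx A L); split=> //.
  by apply: eqmx_trans (preimmx_mul _ _) _; apply/capmx_idPr; rewrite eqL1.
split.
- rewrite sub_preimmx -mulmxA mulmxE -commA -mulmxE mulmxA.
  by apply: submx_trans LT; rewrite submxMr // -sub_preimmx.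
- rewrite sub_preimmx mulmxE.
  have Xm : A * T ^+ m = T ^+ m * A by exact: (commrX m (commA : GRing.comm A T)).
  rewrite -Xm -mulmxE; apply: submx_trans L1m.
  by rewrite submxMr // eqL1.
have := rank_preimmx A L.
have LA : (L <= A)%MS by rewrite eqL1.
rewrite (capmx_idPr LA) eqL1.
have : (k <= c)%N by rewrite leq_div.
by move: (\rank _) (\rank _) (\rank L) rL rL1; lia.
Qed.

(** N divides T^m with a complementary factor N', and the corank bounds of the two
  factors add up to m * d. For m = r the product vanishes, which forces both
  bounds to be equalities: see [power_factor_rank]. The bounds themselves are
  lower bounds on ranks, which pass to products. *)
Definition power_factor m c (N : 'M[F]_n) : Prop :=
  exists N', [/\ N * T = T * N, N * N' = T ^+ m,
    (n <= \rank N + c)%N & (n + c <= \rank N' + m * d)%N].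

Lemma power_factor1 : power_factor 0 0 1%:M.
Proof.
exists 1%:M; split; rewrite ?mxrank1 ?addn0 ?mul0n ?addn0 //.
  by rewrite idmxE mulr1 mul1r.
by rewrite expr0 idmxE mulr1.
Qed.

Lemma power_factor_dilation m c k (N G : 'M[F]_n) :
    (k <= d)%N -> power_factor m c N ->
    G \in unitmx -> G * T = T * G ->
  power_factor m.+1 (c + k) (N *m (dilation k *m G)).
Proof.
move=> kd [N' [commN NN' rN rN']] Gunit commG.
exists (invmx G *m codilation k *m N'); split.
- by rewrite !mulmxE -!mulrA commG (mulrA (dilation k)) dilation_comm !mulrA commN.
- rewrite -mulmxE !mulmxA mulmxK // -(mulmxA N).
  by rewrite !mulmxE dilation_codilation commN -mulrA NN' exprS.
- rewrite mulmxA mxrankMfree ?row_free_unit //.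
  have := mxrank_mul_lower N (dilation k); have := corank_dilation kd.
  by move: (\rank _) (\rank _) (\rank _) rN; lia.
have -> : \rank (invmx G *m codilation k *m N') = \rank (codilation k *m N').
  by rewrite -mulmxA (eqmxMfull (codilation k *m N')) // row_full_unit unitmx_inv.
have := mxrank_mul_lower (codilation k) N'; have := corank_codilation kd.
by move: (\rank _) (\rank _) (\rank _) rN'; rewrite mulSn; lia.
Qed.

Lemma power_factor_rank c (N : 'M[F]_n) : power_factor r c N -> (\rank N + c = n)%N.
Proof.
move=> [N' [_ NN' rN]]; rewrite mulnC -hn => rN'.
have /mulmx0_rank_max : N *m N' = 0 by rewrite mulmxE NN' jordan_nilpotent.
by move: (\rank _) (\rank _) rN rN'; lia.
Qed.

(** Both submodules factor through the same dilation by [exists_factor], with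
  invertible G1 and G2 that commute with T. The matrices that commute with T form
  a linear space, so G1 and G2 are joined by a line in it, invertible outside the
  zeros of its determinant. Multiply the curve for the smaller power of T by it. *)
Lemma exists_curve m c (L1 L2 : 'M[F]_n) :
    stablemx L1 T -> (T ^+ m <= L1)%MS -> (\rank L1 + c = n)%N ->
    stablemx L2 T -> (T ^+ m <= L2)%MS -> (\rank L2 + c = n)%N ->
  exists (N : 'M[{poly F}]_n) (delta : {poly F}),
    [/\ delta != 0, (evalmx 0 N :=: L1)%MS, (evalmx 1 N :=: L2)%MS
      & forall x, delta.[x] != 0 -> power_factor m c (evalmx x N)].
Proof.
elim: m c L1 L2 => [|m IH] c L1 L2 LT1 Tm1 rL1 LT2 Tm2 rL2.
  have full x (L : 'M_n) : (T ^+ 0 <= L)%MS -> (evalmx x 1%:M :=: L)%MS.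
    rewrite expr0 -idmxE => fullL; apply/eqmxP.
    by rewrite /evalmx map_mx1 fullL submx1.
  have c0 : c = 0%N.
    by have := mxrankS Tm1; rewrite expr0 -idmxE mxrank1; move: (\rank L1) rL1; lia.
  exists 1%:M, 1; rewrite oner_neq0; split=> //; try exact: full.
  by move=> x _; rewrite c0 /evalmx map_mx1; exact: power_factor1.
have [kd [G1 [M1 [G1u G1c e1 [MT1 Mm1 rM1]]]]] := exists_factor LT1 Tm1 rL1.
have [_ [G2 [M2 [G2u G2c e2 [MT2 Mm2 rM2]]]]] := exists_factor LT2 Tm2 rL2.
set k := (c %/ _)%N in kd e1 rM1 e2 rM2.
have [N [delta [delta0 N0 N1 bal]]] := IH _ _ _ MT1 Mm1 rM1 MT2 Mm2 rM2.
have eval_line x : evalmx x (N *m (map_mx polyC (dilation k) *m line G1 G2)) =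
    evalmx x N *m (dilation k *m ((1 - x) *: G1 + x *: G2)).
  by rewrite !evalmxM evalmx_const evalmx_line.
exists (N *m (map_mx polyC (dilation k) *m line G1 G2)).
(* The determinant excludes the parameters at which G degenerates. *)
exists (delta * \det (line G1 G2)); split.
- rewrite mulf_neq0 //; apply: contraTneq G1u => det0.
  have <- : evalmx 0 (line G1 G2) = G1.
    by rewrite evalmx_line subr0 scale1r scale0r addr0.
  by rewrite unitmxE unitfE det_map_mx det0 rmorph0 eqxx.
- rewrite eval_line subr0 scale1r scale0r addr0.
  exact: eqmx_trans (eqmxMr _ N0) e1.
- rewrite eval_line subrr scale1r scale0r add0r.
  exact: eqmx_trans (eqmxMr _ N1) e2.
move=> x; rewrite hornerM mulf_eq0 negb_or => /andP [dx detx].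
rewrite eval_line -(subnK (leq_div c m.+1)) -/k; apply: power_factor_dilation => //.
- exact: bal.
- by rewrite -evalmx_line unitmxE unitfE det_map_mx.
by rewrite -!mulmxE mulmxDl mulmxDr -!scalemxAl -!scalemxAr !mulmxE G1c G2c.
Qed.
End Jordan.

(** * Points of the Grassmannian and their Pluecker coordinates *)

Section GrassmannPoints.
Variables (F : fieldType) (n : nat).

(** The row index is \dim U, so that no cast is needed: for L in the Grassmannian
  the dimension equals l only up to a proof, as in [basis_mx]. *)
Definition vspace_mx (U : {vspace 'rV[F]_n}) : 'M_(\dim U, n) :=
  \matrix_(i < \dim U) (vbasis U)`_i.

Lemma mem_vspace_mx (U : {vspace _}) (v : 'rV_n) : (v \in U) = (v <= vspace_mx U)%MS.
Proof.
apply/idP/idP => [/coord_vbasis -> | /submxP [D ->]].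
  apply: summx_sub => i _; apply: scalemx_sub.
  by rewrite -[_`_i](rowK (fun i : 'I__ => (vbasis U)`_i)) row_sub.
rewrite mulmx_sum_row; apply: memv_suml => i _; apply: memvZ.
by rewrite rowK vbasis_mem // mem_nth // size_tuple.
Qed.

Lemma rank_vspace_mx U : \rank (vspace_mx U) = \dim U.
Proof.
apply/eqP; rewrite -[_ == _]/(row_free _) -kermx_eq0; apply/rowV0P => v.
move/sub_kermxP; rewrite mulmx_sum_row => v0; apply/rowP=> i; rewrite mxE.
have /freeP/(_ (v 0)) := basis_free (vbasisP U); apply.
by rewrite -[RHS]v0; apply: eq_bigr => j _; rewrite rowK.
Qed.

Variable l : nat.

Definition basis_mx (L : Gr F l n) : 'M[F]_(l, n) :=
  \matrix_(i < l) (vbasis (val L))`_i.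

Lemma mem_basis_mx (L : Gr F l n) (v : 'rV_n) :
  (v \in val L) = (v <= basis_mx L)%MS.
Proof.
case: L => U dimU; rewrite /basis_mx /=.
by case: _ / (eqP dimU); exact: mem_vspace_mx.
Qed.

Lemma rank_basis_mx (L : Gr F l n) : \rank (basis_mx L) = l.
Proof.
case: L => U dimU; rewrite /basis_mx /=.
by case: _ / (eqP dimU); exact: rank_vspace_mx.
Qed.

Lemma exists_Gr_of_mx m (N : 'M[F]_(m, n)) : \rank N = l ->
  exists L : Gr F l n, (basis_mx L :=: N)%MS.
Proof.
move=> rN; pose U := limg (linfun (mulmxr N : 'rV[F]_m -> 'rV[F]_n)).
have memU v : (v \in U) = (v <= N)%MS.
  by apply/memv_imgP/submxP => [[u _ ->]|[u ->]]; exists u; rewrite ?memvf // lfunE.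
have eqU : (vspace_mx U :=: N)%MS.
  by apply/eqmxP/andP; split; apply/rV_subP=> v; rewrite -mem_vspace_mx memU.
have dimU : \dim U == l by rewrite -rank_vspace_mx eqU rN.
exists (exist _ U dimU); apply/eqmxP/andP.
by split; apply/rV_subP=> v; rewrite -mem_basis_mx memU.
Qed.
End GrassmannPoints.

Definition mx_pluecker (R : comNzRingType) l n (A : 'M[R]_(l, n))
    (k : 'I_('C(n, l))) : R :=
  \det (colsub (lsubset_col k) A).

Lemma plueckerE (F : fieldType) l n (L : Gr F l n) :
  pluecker L =1 mx_pluecker (basis_mx L).
Proof. by move=> k; congr (\det _); apply/matrixP=> i j; rewrite !mxE. Qed.

Lemma mx_plueckerM (R : comNzRingType) l n (C : 'M[R]_l) (A : 'M[R]_(l, n)) k :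
  mx_pluecker (C *m A) k = \det C * mx_pluecker A k.
Proof.
rewrite /mx_pluecker -det_mulmx; congr (\det _).
apply/matrixP=> i j; rewrite !mxE; apply: eq_bigr => t _; rewrite !mxE //.
Qed.

Lemma map_mx_pluecker (R S : comNzRingType) (f : {rmorphism R -> S}) l n
  (A : 'M[R]_(l, n)) k : f (mx_pluecker A k) = mx_pluecker (map_mx f A) k.
Proof.
rewrite /mx_pluecker -det_map_mx; congr (\det _).
by apply/matrixP=> i j; rewrite !mxE.
Qed.

Lemma dhomog_meval_scale (R : comNzRingType) m e (p : {mpoly R[m]}) (c : R) v :
  p \is e.-homog -> p.@[fun i => c * v i] = c ^+ e * p.@[v].
Proof.
move=> /dhomogP hp; rewrite !mevalE mulr_sumr; apply: eq_big_seq => u up.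
rewrite mulrCA; congr (_ * _).
have <- : mdeg u = e by exact: hp.
rewrite mdegE expr_sum -big_split /=.
by apply: eq_bigr => i _; rewrite exprMn.
Qed.

Lemma meval_horner (R : comNzRingType) m (p : {mpoly R[m]}) (w : 'I_m -> {poly R}) :
  exists P : {poly R}, forall x, P.[x] = p.@[fun i => (w i).[x]].
Proof.
exists (\sum_(u <- msupp p) (p@_u)%:P * \prod_i w i ^+ u i) => x.
rewrite horner_sum mevalE; apply: eq_bigr => u _; rewrite hornerM hornerC.
by rewrite horner_prod; congr (_ * _); apply: eq_bigr => i _; rewrite horner_exp.
Qed.

(** * Irreducibility *)

(** Let a closed set A miss L1 and a closed set B miss L2. An equation of A that
  is nonzero at L1 pulls back along the curve to a nonzero polynomial in one
  variable, and so does an equation of B that is nonzero at L2. A parameter where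
  both, and delta, are nonzero gives a point of X outside A and B. *)
Lemma irreducible_of_curves (F : closedFieldType) l n (X : Gr F l n -> Prop) :
    (exists L, X L) ->
    (forall L1 L2, X L1 -> X L2 ->
      exists (N : 'M[{poly F}]_n) (delta : {poly F}),
      [/\ delta != 0, (basis_mx L1 <= evalmx 0 N)%MS,
          (basis_mx L2 <= evalmx 1 N)%MS &
          forall x, delta.[x] != 0 ->
            exists L, X L /\ (evalmx x N <= basis_mx L)%MS]) ->
  irreducible (@zariski_closed F l n) X.
Proof.
move=> X0 curves; split=> // A B [IA [homA eqA]] [IB [homB eqB]] cover.
have outside (Z : Gr F l n -> Prop) (I : {mpoly F['C(n, l)]} -> Prop) :
    (forall L, Z L <-> (forall p, I p -> p.@[pluecker L] = 0)) ->
    ~ (forall L, X L -> Z L) ->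
    exists L p, [/\ X L, I p & p.@[pluecker L] != 0].
  move=> eqZ notZ; apply: NNPP => none; case: notZ => L XL.
  apply/eqZ => p Ip; apply: NNPP => /eqP pL; apply: none.
  by exists L, p.
apply: NNPP => /not_or_and [/(outside A IA eqA) [L1 [p [X1 Ip p1]]]].
move=> /(outside B IB eqB) [L2 [q [X2 Iq q2]]].
have [N [delta [delta0 /submxP [S1 N0] /submxP [S2 N1] onX]]] := curves _ _ X1 X2.
(* A fixed S turns the n rows of the curve into l rows; S1 and S2 are chosen so
   that these are the given bases at the parameters 0 and 1. *)
have along (S : 'M[F]_(l, n)) (f : {mpoly F['C(n, l)]}) : exists P : {poly F},
    forall x, P.[x] = f.@[mx_pluecker (S *m evalmx x N)].
  have [P PE] := meval_horner f (mx_pluecker (map_mx polyC S *m N)).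
  exists P => x; rewrite PE; apply: meval_eq => k.
  rewrite -[_.[x]]/(horner_eval x _) map_mx_pluecker; congr mx_pluecker.
  rewrite map_mxM; congr (_ *m _); exact: evalmx_const.
have [P PE] := along S1 p; have [Q QE] := along S2 q.
have nonzero (S : 'M[F]_(l, n)) (L : Gr F l n) f x (R : {poly F}) :
    basis_mx L = S *m evalmx x N -> f.@[pluecker L] != 0 ->
    (forall x, R.[x] = f.@[mx_pluecker (S *m evalmx x N)]) -> R != 0.
  move=> LS fL RE; apply: contraNneq fL => R0.
  by rewrite (meval_eq f (plueckerE L)) LS -RE R0 horner0.
have P0 := nonzero _ _ _ _ _ N0 p1 PE; have Q0 := nonzero _ _ _ _ _ N1 q2 QE.
have /closed_nonrootP [x] : delta * P * Q != 0 by rewrite !mulf_neq0.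
rewrite /root !hornerM !mulf_eq0 !negb_or => /andP [/andP [dx Px] Qx].
have [L [XL /submxP [C NL]]] := onX x dx.
(* The l rows need not be independent at x: their minors are a multiple, possibly
   0, of the coordinates of L, and homogeneity of f copes with both cases. *)
have vanish (S : 'M[F]_(l, n)) f e : f \is e.-homog -> f.@[pluecker L] = 0 ->
    f.@[mx_pluecker (S *m evalmx x N)] = 0.
  move=> homf fL; rewrite NL mulmxA.
  transitivity (f.@[fun k => \det (S *m C) * pluecker L k]).
    by apply: meval_eq => k; rewrite mx_plueckerM plueckerE.
  by rewrite (dhomog_meval_scale _ _ homf) fL mulr0.
case: (cover L XL) => [/eqA/(_ p Ip)|/eqB/(_ q Iq)] fL.
  have [e he] := homA p Ip.
  by move: Px; rewrite PE (vanish _ _ e) ?eqxx.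
have [e he] := homB q Iq.
by move: Qx; rewrite QE (vanish _ _ e) ?eqxx.
Qed.

Lemma map_jordan_rect (R S : nzRingType) (f : {rmorphism R -> S}) n r :
  map_mx f (jordan_rect R n r) = jordan_rect S n r.
Proof. by apply/matrixP=> i j; rewrite !mxE rmorph_nat. Qed.

Lemma Gr_fixedE (F : fieldType) l n (T : 'M[F]_n) (L : Gr F l n) :
  Gr_fixed T L <-> stablemx (basis_mx L) T.
Proof.
split=> [fixL|stabL v]; last first.
  by rewrite !mem_basis_mx => /(submxMr T) /submx_trans; apply.
apply/row_subP=> i; rewrite row_mul -mem_basis_mx; apply: fixL.
by rewrite mem_basis_mx row_sub.
Qed.

(** The span of the last l unit vectors is stable, because T maps each unit vector
  to the next one or to 0. *)
Lemma exists_Gr_fixed (F : fieldType) d r l n :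
  n = (d * r)%N -> (l <= n)%N -> exists L : Gr F l n, Gr_fixed (jordan_rect F n r) L.
Proof.
move=> hn ln; have [|L eqL] := @exists_Gr_of_mx F n l n (copid_mx (n - l)).
  by rewrite rank_copid_mx ?leq_subr // subKn.
exists L; apply/Gr_fixedE; rewrite (eqmx_stable _ eqL).
have row_copid (i : 'I_n) : row i (copid_mx (n - l)) =
    if (i < n - l)%N then 0 else delta_mx 0 i :> 'rV[F]_n.
  apply/rowP=> j; rewrite !mxE; case: ltnP => _; rewrite ?andbT ?andbF mxE ?subrr //.
  by rewrite subr0 eqxx eq_sym.
apply/row_subP=> i; rewrite row_mul row_copid.
case: ltnP => [_|li]; first by rewrite mul0mx sub0mx.
rewrite -rowE; have [[_ ->]|[j [ji _ ->]]] := row_jordan F hn i; first exact: sub0mx.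
suff <- : row j (copid_mx (n - l)) = delta_mx 0 j :> 'rV[F]_n by exact: row_sub.
by rewrite row_copid ji ltnNge leqW.
Qed.

Theorem theorem11 (K : fieldType) (F : closedFieldType)
    (iota : {rmorphism K -> F}) (hF : is_algebraic_closure iota)
    (d r n l : nat) (hd : (2 <= d)%N) (hr : (2 <= r)%N) (hn : n = (d * r)%N)
    (hl : (l <= n)%N) :
  irreducible (@zariski_closed F l n)
    (@Gr_fixed F l n (map_mx iota (jordan_rect K n r))).
Proof.
rewrite map_jordan_rect; have r_gt0 : (0 < r)%N by exact: ltnW.
apply: irreducible_of_curves; first exact: exists_Gr_fixed hn hl.
have codim (L : Gr F l n) : (\rank <<basis_mx L>>%MS + (n - l) = n)%N.
  by rewrite genmxE rank_basis_mx subnKC.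
have nil (L : 'M[F]_n) : (jordan_rect F n r ^+ r <= L)%MS.
  by rewrite (jordan_nilpotent _ _ r_gt0) sub0mx.
have stab (L : Gr F l n) : Gr_fixed (jordan_rect F n r) L ->
    stablemx <<basis_mx L>>%MS (jordan_rect F n r).
  by move=> /Gr_fixedE; rewrite (eqmx_stable _ (genmxE _)).
move=> L1 L2 X1 X2.
have [N [delta [delta0 N0 N1 onX]]] := exists_curve r_gt0 hn
  (stab _ X1) (nil _) (codim L1) (stab _ X2) (nil _) (codim L2).
exists N, delta; split=> //; rewrite ?N0 ?N1 ?genmxE //.
move=> x /onX bal; have rN := power_factor_rank r_gt0 hn bal.
have [|L eqL] := @exists_Gr_of_mx F n l n (evalmx x N).
  by move: (\rank _) rN => rk; lia.
exists L; split; last by rewrite eqL.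
apply/Gr_fixedE; rewrite (eqmx_stable _ eqL).
by case: bal => N' [commN _ _ _]; rewrite mulmxE commN submxMl.
Qed.
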